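(* Let $(A,v)$ be a very true pseudo-BCK algebra and let $H$ be a normal $v$-deductive system of $A$. Define $\hat{v}:A/H\to A/H$ by $\hat{v}([x]_H)=[v(x)]_H$ for all $x\in A$. Then $\hat{v}$ is a very true operator on the quotient pseudo-BCK algebra $A/H$.
   Context: A pseudo-BCK algebra is a structure $(A,\leq,\rightarrow,\rightsquigarrow,1)$ where $\leq$ is a binary relation on $A$, $\rightarrow$ and $\rightsquigarrow$ are binary operations on $A$ and $1\in A$, such that for all $x,y,z\in A$: $x\rightarrow y\leq (y\rightarrow z)\rightsquigarrow (x\rightarrow z)$ and $x\rightsquigarrow y\leq (y\rightsquigarrow z)\rightarrow (x\rightsquigarrow z)$; $x\leq (x\rightarrow y)\rightsquigarrow y$ and $x\leq (x\rightsquigarrow y)\rightarrow y$; $x\leq x$; $x\leq 1$; if $x\leq y$ and $y\leq x$ then $x=y$; $x\leq y$ iff $x\rightarrow y=1$ iff $x\rightsquigarrow y=1$. A very true operator on a pseudo-BCK algebra $A$ is a map $v:A\to A$ such that for all $x,y\in A$: $v(1)=1$; $v(x)\leq x$; $v(x)\leq v(v(x))$; $v(x\rightarrow y)\leq v(x)\rightarrow v(y)$ and $v(x\rightsquigarrow y)\leq v(x)\rightsquigarrow v(y)$. The pair $(A,v)$ is then called a very true pseudo-BCK algebra. A deductive system of $A$ is a subset $H\subseteq A$ with $1\in H$ such that $x\in H$ and $x\rightarrow y\in H$ imply $y\in H$; it is normal if $x\rightarrow y\in H$ iff $x\rightsquigarrow y\in H$ for all $x,y\in A$. A normal $v$-deductive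 system of $A$ is a normal deductive system $H$ with $v(H)\subseteq H$. For a normal deductive system $H$, the relation $(x,y)\in\Theta_H$ iff $x\rightarrow y\in H$ and $y\rightarrow x\in H$ is a congruence on $A$; the class of $x$ is denoted $[x]_H$, and the quotient $A/H$ is a pseudo-BCK algebra with the induced operations and unit $[1]_H$. *)

(* Defs.v *)
From HB Require Import structures.
From mathcomp Require Import all_boot.
From mathcomp Require Import boolp classical_sets.

Set Implicit Arguments.
Unset Strict Implicit.
Unset Printing Implicit Defensive.

Local Open Scope classical_set_scope.
Local Open Scope quotient_scope.

Declare Scope pbck_scope.
Delimit Scope pbck_scope with pbck.

Reserved Notation "x ->> y" (at level 55, right associativity).
Reserved Notation "x ~>> y" (at level 55, right associativity).
Reserved Notation "x <<= y" (at level 70, no associativity).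

HB.mixin Record isPseudoBCK (A : Type) := {
  pb_le : A -> A -> Prop;
  pb_imp : A -> A -> A;
  pb_simp : A -> A -> A;
  pb_one : A;
  pb_imp_comp : forall x y z,
    pb_le (pb_imp x y) (pb_simp (pb_imp y z) (pb_imp x z));
  pb_simp_comp : forall x y z,
    pb_le (pb_simp x y) (pb_imp (pb_simp y z) (pb_simp x z));
  pb_le_imp_simp : forall x y, pb_le x (pb_simp (pb_imp x y) y);
  pb_le_simp_imp : forall x y, pb_le x (pb_imp (pb_simp x y) y);
  pb_le_refl : forall x, pb_le x x;
  pb_le_one : forall x, pb_le x pb_one;
  pb_le_anti : forall x y, pb_le x y -> pb_le y x -> x = y;
  pb_leE_imp : forall x y, pb_le x y <-> pb_imp x y = pb_one;
  pb_leE_simp : forall x y, pb_le x y <-> pb_simp x y = pb_one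
}.

#[short(type="pseudoBCKType")]
HB.structure Definition PseudoBCK := { A of isPseudoBCK A }.

Notation "x ->> y" := (pb_imp x y) : pbck_scope.
Notation "x ~>> y" := (pb_simp x y) : pbck_scope.
Notation "x <<= y" := (pb_le x y) : pbck_scope.
Notation "1" := pb_one : pbck_scope.
Local Open Scope pbck_scope.

Record very_true_operator (A : pseudoBCKType) (v : A -> A) : Prop := {
  vt_one : v 1 = 1;
  vt_le : forall x, v x <<= x;
  vt_idem : forall x, v x <<= v (v x);
  vt_imp : forall x y, v (x ->> y) <<= v x ->> v y;
  vt_simp : forall x y, v (x ~>> y) <<= v x ~>> v y
}.

Record deductive_system (A : pseudoBCKType) (H : set A) : Prop := {
  ds_one : H 1;
  ds_mp : forall x y, H x -> H (x ->> y) -> H y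
}.

Record normal_deductive_system (A : pseudoBCKType) (H : set A) : Prop := {
  nds_ds :> deductive_system H;
  nds_normal : forall x y, H (x ->> y) <-> H (x ~>> y)
}.

Record normal_v_deductive_system (A : pseudoBCKType) (v : A -> A)
    (H : set A) : Prop := {
  nvds_nds :> normal_deductive_system H;
  nvds_stable : v @` H `<=` H
}.

Definition ds_equiv (A : pseudoBCKType) (H : set A) (x y : A) : Prop :=
  H (x ->> y) /\ H (y ->> x).

Section PseudoBCKTheory.
Variable A : pseudoBCKType.
Implicit Types x y z : A.

Lemma pb_one_le x : 1 <<= x -> x = 1.
Proof. by move=> h; apply: pb_le_anti => //; apply: pb_le_one. Qed.

Lemma pb_imp1x x : 1 ->> x = x.
Proof.
apply: pb_le_anti.
  exact/pb_leE_simp/pb_one_le/pb_le_imp_simp.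
have := pb_le_simp_imp x x.
by have /pb_leE_simp-> := pb_le_refl x.
Qed.

Lemma pb_simp1x x : 1 ~>> x = x.
Proof.
apply: pb_le_anti.
  exact/pb_leE_imp/pb_one_le/pb_le_simp_imp.
have := pb_le_imp_simp x x.
by have /pb_leE_imp-> := pb_le_refl x.
Qed.

Lemma pb_imp_antil x y z : x <<= y -> y ->> z <<= x ->> z.
Proof.
move=> /pb_leE_imp xy; have := pb_imp_comp x y z.
by rewrite xy => /pb_one_le/pb_leE_simp.
Qed.

Lemma pb_simp_antil x y z : x <<= y -> y ~>> z <<= x ~>> z.
Proof.
move=> /pb_leE_simp xy; have := pb_simp_comp x y z.
by rewrite xy => /pb_one_le/pb_leE_imp.
Qed.

Lemma pb_le_trans x y z : x <<= y -> y <<= z -> x <<= z.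
Proof.
move=> xy /pb_leE_imp yz; have := pb_imp_antil z xy.
by rewrite yz => /pb_one_le/pb_leE_imp.
Qed.

Lemma pb_imp_comp2 x y z : y ->> z <<= (x ->> y) ->> (x ->> z).
Proof.
exact: pb_le_trans (pb_le_simp_imp _ _) (pb_imp_antil _ (pb_imp_comp x y z)).
Qed.

Lemma pb_simp_comp2 x y z : y ~>> z <<= (x ~>> y) ~>> (x ~>> z).
Proof.
exact: pb_le_trans (pb_le_imp_simp _ _) (pb_simp_antil _ (pb_simp_comp x y z)).
Qed.

End PseudoBCKTheory.

Section Quotient.
Variables (A : pseudoBCKType) (H : set A) (nH : normal_deductive_system H).
Implicit Types x y z : A.

Lemma ds_le x y : H x -> x <<= y -> H y.
Proof.
by move=> Hx /pb_leE_imp xy; apply: (ds_mp nH Hx); rewrite xy; apply: ds_one nH.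
Qed.

Lemma ds_equiv_refl x : ds_equiv H x x.
Proof. by split; have /pb_leE_imp-> := pb_le_refl x; apply: ds_one nH. Qed.

Lemma ds_equiv_sym x y : ds_equiv H x y -> ds_equiv H y x.
Proof. by case. Qed.

Lemma ds_imp_trans x y z : H (x ->> y) -> H (y ->> z) -> H (x ->> z).
Proof. by move=> xy yz; apply: (ds_mp nH xy); apply: ds_le yz (pb_imp_comp2 _ _ _). Qed.

Lemma ds_equiv_trans x y z : ds_equiv H x y -> ds_equiv H y z -> ds_equiv H x z.
Proof.
move=> [xy yx] [yz zy].
by split; [apply: ds_imp_trans xy yz | apply: ds_imp_trans zy yx].
Qed.

Lemma ds_equiv_imp x x' y y' :
  ds_equiv H x x' -> ds_equiv H y y' -> ds_equiv H (x ->> y) (x' ->> y').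
Proof.
move=> [xx' x'x] [yy' y'y].
have K a b c : H (a ->> b) -> H ((b ->> c) ->> (a ->> c)).
  by move=> ab; apply/(nds_normal nH); apply: ds_le ab (pb_imp_comp _ _ _).
have L a b c : H (b ->> c) -> H ((a ->> b) ->> (a ->> c)).
  by move=> bc; apply: ds_le bc (pb_imp_comp2 _ _ _).
by split; [apply: ds_imp_trans (K _ _ _ x'x) (L _ _ _ yy')
         | apply: ds_imp_trans (K _ _ _ xx') (L _ _ _ y'y)].
Qed.

Lemma ds_equiv_simp x x' y y' :
  ds_equiv H x x' -> ds_equiv H y y' -> ds_equiv H (x ~>> y) (x' ~>> y').
Proof.
move=> [/(nds_normal nH) xx' /(nds_normal nH) x'x].
move=> [/(nds_normal nH) yy' /(nds_normal nH) y'y].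
have K a b c : H (a ~>> b) -> H ((b ~>> c) ->> (a ~>> c)).
  by move=> ab; apply: ds_le ab (pb_simp_comp _ _ _).
have L a b c : H (b ~>> c) -> H ((a ~>> b) ->> (a ~>> c)).
  by move=> bc; apply/(nds_normal nH); apply: ds_le bc (pb_simp_comp2 _ _ _).
by split; [apply: ds_imp_trans (K _ _ _ x'x) (L _ _ _ yy')
         | apply: ds_imp_trans (K _ _ _ xx') (L _ _ _ y'y)].
Qed.

(* {classic A} equips the arbitrary type A with the choice structure required by
   {eq_quot _}; it is convertible to A. *)
Definition ds_rel : rel {classic A} := fun x y => `[< ds_equiv H x y >].

Fact ds_rel_refl : reflexive ds_rel.
Proof. by move=> x; apply/asboolP; apply: ds_equiv_refl. Qed.

Fact ds_rel_sym : symmetric ds_rel.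
Proof. by move=> x y; apply/asboolP/asboolP; apply: ds_equiv_sym. Qed.

Fact ds_rel_trans : transitive ds_rel.
Proof.
by move=> y x z /asboolP xy /asboolP yz; apply/asboolP; apply: ds_equiv_trans yz.
Qed.

Canonical ds_equiv_rel := EquivRel ds_rel ds_rel_refl ds_rel_sym ds_rel_trans.

Definition ds_quot : Type := {eq_quot ds_equiv_rel}.

Definition ds_class (x : A) : ds_quot := \pi_({eq_quot ds_equiv_rel}) x.

Definition ds_repr (X : ds_quot) : A := repr (X : {eq_quot ds_equiv_rel}).

Lemma ds_classP x y : ds_class x = ds_class y <-> ds_equiv H x y.
Proof.
split=> [/(@eqmodP _ ds_equiv_rel)/asboolP //|xy].
by apply/(@eqmodP _ ds_equiv_rel)/asboolP.
Qed.

Lemma ds_reprK X : ds_class (ds_repr X) = X.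
Proof. exact: (@reprK _ {eq_quot ds_equiv_rel} X). Qed.

Lemma ds_repr_class x : ds_equiv H (ds_repr (ds_class x)) x.
Proof. by apply/ds_classP; rewrite ds_reprK. Qed.

Definition quot_imp (X Y : ds_quot) : ds_quot :=
  ds_class (ds_repr X ->> ds_repr Y).

Definition quot_simp (X Y : ds_quot) : ds_quot :=
  ds_class (ds_repr X ~>> ds_repr Y).

Definition quot_one : ds_quot := ds_class 1.

(* In a pseudo-BCK algebra the order is determined by the implication, so this
   is the only possible order on the quotient. *)
Definition quot_le (X Y : ds_quot) : Prop := quot_imp X Y = quot_one.

Lemma quot_impE x y : quot_imp (ds_class x) (ds_class y) = ds_class (x ->> y).
Proof. by apply/ds_classP/ds_equiv_imp; apply: ds_repr_class. Qed.

Lemma quot_simpE x y :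
  quot_simp (ds_class x) (ds_class y) = ds_class (x ~>> y).
Proof. by apply/ds_classP/ds_equiv_simp; apply: ds_repr_class. Qed.

Lemma ds_class_one x : ds_class x = quot_one <-> H x.
Proof.
split=> [/ds_classP[_]|Hx]; first by rewrite pb_imp1x.
apply/ds_classP; split; last by rewrite pb_imp1x.
by have /pb_leE_imp-> := pb_le_one x; apply: ds_one nH.
Qed.

Lemma quot_leE x y : quot_le (ds_class x) (ds_class y) <-> H (x ->> y).
Proof. by rewrite /quot_le quot_impE; apply: ds_class_one. Qed.

Lemma quot_le_class x y : x <<= y -> quot_le (ds_class x) (ds_class y).
Proof. by move=> /pb_leE_imp xy; apply/quot_leE; rewrite xy; apply: ds_one nH. Qed.

Lemma ds_quotW (P : ds_quot -> Prop) : (forall x, P (ds_class x)) -> forall X, P X.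
Proof. by move=> h X; rewrite -(ds_reprK X). Qed.

Fact quot_imp_comp X Y Z :
  quot_le (quot_imp X Y) (quot_simp (quot_imp Y Z) (quot_imp X Z)).
Proof.
elim/ds_quotW: X => x; elim/ds_quotW: Y => y; elim/ds_quotW: Z => z.
by rewrite !quot_impE quot_simpE; apply/quot_le_class/pb_imp_comp.
Qed.

Fact quot_simp_comp X Y Z :
  quot_le (quot_simp X Y) (quot_imp (quot_simp Y Z) (quot_simp X Z)).
Proof.
elim/ds_quotW: X => x; elim/ds_quotW: Y => y; elim/ds_quotW: Z => z.
by rewrite !quot_simpE quot_impE; apply/quot_le_class/pb_simp_comp.
Qed.

Fact quot_le_imp_simp X Y : quot_le X (quot_simp (quot_imp X Y) Y).
Proof.
elim/ds_quotW: X => x; elim/ds_quotW: Y => y.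
by rewrite quot_impE quot_simpE; apply/quot_le_class/pb_le_imp_simp.
Qed.

Fact quot_le_simp_imp X Y : quot_le X (quot_imp (quot_simp X Y) Y).
Proof.
elim/ds_quotW: X => x; elim/ds_quotW: Y => y.
by rewrite quot_simpE quot_impE; apply/quot_le_class/pb_le_simp_imp.
Qed.

Fact quot_le_refl X : quot_le X X.
Proof. by elim/ds_quotW: X => x; apply/quot_le_class/pb_le_refl. Qed.

Fact quot_le_one X : quot_le X quot_one.
Proof. by elim/ds_quotW: X => x; apply/quot_le_class/pb_le_one. Qed.

Fact quot_le_anti X Y : quot_le X Y -> quot_le Y X -> X = Y.
Proof.
elim/ds_quotW: X => x; elim/ds_quotW: Y => y /quot_leE xy /quot_leE yx.
exact/ds_classP.
Qed.

Fact quot_leE_imp X Y : quot_le X Y <-> quot_imp X Y = quot_one.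
Proof. by []. Qed.

Fact quot_leE_simp X Y : quot_le X Y <-> quot_simp X Y = quot_one.
Proof.
elim/ds_quotW: X => x; elim/ds_quotW: Y => y.
rewrite quot_simpE; split.
  by move=> /quot_leE/(nds_normal nH)/ds_class_one.
by move=> /ds_class_one/(nds_normal nH)/quot_leE.
Qed.

HB.instance Definition _ := @isPseudoBCK.Build ds_quot quot_le quot_imp
  quot_simp quot_one quot_imp_comp quot_simp_comp quot_le_imp_simp
  quot_le_simp_imp quot_le_refl quot_le_one quot_le_anti quot_leE_imp
  quot_leE_simp.

End Quotient.

(* Main.v *)
Require Import Defs.
From mathcomp Require Import all_boot.
From mathcomp Require Import boolp classical_sets.

(** The map on the quotient exists because [v] preserves membership of
    implications in [H]: if [H] contains [x ->> y], then by stability it contains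
    [v (x ->> y)], and being upward closed it contains the larger element
    [v x ->> v y] ([ds_imp_stable]).  Applied in both directions this says that
    [v] respects the congruence of [H] ([ds_equiv_stable]).  The projection onto
    the quotient is surjective, which gives uniqueness of the induced map; it is
    moreover a monotone homomorphism, so each law of a very true operator, being
    an equation or an inequality between terms in [v] and the operations, is the
    image of the same law in [A] ([very_true_quot]). *)

Local Open Scope pbck_scope.

Section ClassMorphism.
Variables (A : pseudoBCKType) (H : set A) (nH : normal_deductive_system H).

(** [quot_impE] and, below, [quot_simpE] in terms of the operations of the
    pseudo-BCK structure of the quotient: these, and not [quot_imp] and
    [quot_simp], occur syntactically in the laws of a very true operator. *)
Lemma ds_class_imp x y :
  ds_class nH x ->> ds_class nH y = ds_class nH (x ->> y).
Proof. exact: quot_impE. Qed.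

Lemma ds_class_simp x y :
  ds_class nH x ~>> ds_class nH y = ds_class nH (x ~>> y).
Proof. exact: quot_simpE. Qed.

End ClassMorphism.

Section InducedOperator.
Variables (A : pseudoBCKType) (v : A -> A) (H : set A).
Hypotheses (vtv : very_true_operator v) (nvH : normal_v_deductive_system v H).

Lemma ds_imp_stable x y : H (x ->> y) -> H (v x ->> v y).
Proof.
move=> Hxy; apply: (ds_le nvH _ (vt_imp vtv x y)).
by apply: (nvds_stable nvH); exists (x ->> y).
Qed.

Lemma ds_equiv_stable x y : ds_equiv H x y -> ds_equiv H (v x) (v y).
Proof. by case=> xy yx; split; apply: ds_imp_stable. Qed.

Definition quot_op (X : ds_quot nvH) : ds_quot nvH :=
  ds_class nvH (v (ds_repr X)).

Lemma quot_opE x : quot_op (ds_class nvH x) = ds_class nvH (v x).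
Proof. exact/ds_classP/ds_equiv_stable/(ds_repr_class nvH). Qed.

Lemma quot_op_unique (f : ds_quot nvH -> ds_quot nvH) :
  (forall x, f (ds_class nvH x) = ds_class nvH (v x)) -> quot_op = f.
Proof.
by move=> fE; apply: funext => X; elim/ds_quotW: X => x; rewrite quot_opE fE.
Qed.

Lemma very_true_quot : very_true_operator quot_op.
Proof.
split.
- by rewrite [LHS]quot_opE (vt_one vtv).
- by elim/ds_quotW=> x; rewrite quot_opE; apply/quot_le_class/(vt_le vtv).
- by elim/ds_quotW=> x; rewrite !quot_opE; apply/quot_le_class/(vt_idem vtv).
- elim/ds_quotW=> x; elim/ds_quotW=> y.
  rewrite ds_class_imp !quot_opE ds_class_imp.
  exact/quot_le_class/(vt_imp vtv).
- elim/ds_quotW=> x; elim/ds_quotW=> y.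
  rewrite ds_class_simp !quot_opE ds_class_simp.
  exact/quot_le_class/(vt_simp vtv).
Qed.

End InducedOperator.

Theorem theorem5p4 (A : pseudoBCKType) (v : A -> A) (H : set A)
    (vtv : very_true_operator v) (nvH : normal_v_deductive_system v H) :
  exists vhat : ds_quot nvH -> ds_quot nvH,
    unique (fun f : ds_quot nvH -> ds_quot nvH =>
              forall x : A, f (ds_class nvH x) = ds_class nvH (v x)) vhat
    /\ very_true_operator vhat.
Proof.
exists (@quot_op A v H nvH); split; last exact: very_true_quot.
by split=> [x|f fE]; [apply: quot_opE | apply: quot_op_unique].
Qed.
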